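(* Let $J$ be an associative Jordan algebra over a field $\mathbb{F}$ and let $V$ be an $s$-dimensional vector space over $\mathbb{F}$ with basis $e_1,\dots,e_s$. (1) There exists a one-to-one correspondence between the set of $Aut(J)$-orbits on $R_{s}(J)$ and the set of isomorphism classes of $E_{R}(J,V)$. (2) There exists a one-to-one correspondence between the set of $Aut(J)$-orbits on $U_{s}(J)$ and the set of isomorphism classes of $E_{U}(J,V)$.
   Context: A Jordan algebra over $\mathbb{F}$ is a commutative $\mathbb{F}$-algebra $(J,\circ)$ with $x^{2}\circ(x\circ y)=x\circ(x^{2}\circ y)$ for all $x,y$. $Ann(J)=\{x\in J: x\circ J=0\}$. $Z^{2}(J,V)$ is the space of symmetric bilinear maps $\theta:J\times J\to V$ with $\theta(x^{2},x\circ y)=\theta(x,x^{2}\circ y)$ for all $x,y\in J$; $B^{2}(J,V)=\{\delta f: f\in Hom(J,V)\}$ (linear maps) with $\delta f(x,y)=f(x\circ y)$; $H^{2}(J,V)=Z^{2}(J,V)/B^{2}(J,V)$, with $[\theta]$ the class of $\theta$. The radical of $\theta$ is $\theta^{\perp}=\{x\in J:\theta(x,y)=0\ \forall y\in J\}$. For $\theta\in Z^2(J,V)$, $J_{\theta}=J\oplus V$ with product $(x+v)\circ_{J_\theta}(y+w)=x\circ y+\theta(x,y)$ (this is a Jordan algebra). $Aut(J)$ acts on $Z^{2}(J,\mathbb{F})$ by $(\phi\theta)(x,y)=\theta(\phi(x),\phi(y))$, which induces an action on $H^2(J,\mathbb{F})$ and on the Grassmannian $G_s(H^{2}(J,\mathbb{F}))$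 of $s$-dimensional subspaces by $\phi\langle[\theta_1],\dots,[\theta_s]\rangle=\langle[\phi\theta_1],\dots,[\phi\theta_s]\rangle$. $T_s(J)$ is the set of all $W=\langle[\theta_1],\dots,[\theta_s]\rangle\in G_s(H^{2}(J,\mathbb{F}))$ with $\bigcap_{i=1}^{s}\theta_i^{\perp}\cap Ann(J)=0$ (independent of choices). A Jordan algebra $K$ has an annihilator component if $K=I\oplus\mathbb{F}x$ is a direct sum of two ideals with $0\neq x\in Ann(K)$. $E(J,V)$ is the set of all $J_\theta$, $\theta\in Z^2(J,V)$, which have no annihilator components and whose annihilator is $s$-dimensional; equivalently, $E(J,V)=\{J_\theta:\theta=\sum_{i=1}^{s}\theta_i e_i,\ \langle[\theta_1],\dots,[\theta_s]\rangle\in T_s(J)\}$. For $J$ associative, $\mathcal{Z}^{2}(J,\mathbb{F})=\{\theta\in Z^{2}(J,\mathbb{F}):\theta(x,y\circ z)=\theta(x\circ y,z)\ \forall x,y,z\in J\}$ and $\mathcal{H}^{2}(J,\mathbb{F})=\mathcal{Z}^{2}(J,\mathbb{F})/B^{2}(J,\mathbb{F})\subseteq H^2(J,\mathbb{F})$. Then $R_s(J)=\{W\in T_s(J): W\in G_s(\mathcal{H}^{2}(J,\mathbb{F}))\}$, $U_s(J)=T_s(J)\setminus R_s(J)$ (both are $Aut(J)$-stable), $E_R(J,V)=\{J_\theta\in E(J,V): J_\theta\text{ is associative}\}$, $E_U(J,V)=E(J,V)\setminus E_R(J,V)$. Isomorphism classes are taken with respect to algebra isomorphism. The correspondence meant is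 the one sending the orbit of $\langle[\theta_1],\dots,[\theta_s]\rangle$ to the isomorphism class of $J_\theta$, $\theta=\sum_i\theta_i e_i$. *)

(* Defs.v *)
From HB Require Import structures.
From mathcomp Require Import all_boot all_algebra.
From mathcomp Require Import boolp classical_sets functions.

Set Implicit Arguments.
Unset Strict Implicit.
Unset Printing Implicit Defensive.

Import GRing.Theory.

Local Open Scope quotient_scope.
Local Open Scope classical_set_scope.
Local Open Scope ring_scope.

Section LinearAlgebra.
Variables (F : fieldType) (L : lmodType F).

Definition lspan (s : nat) (c : 'I_s -> L) : set L :=
  [set \sum_(i < s) a i *: c i | a in [set: 'I_s -> F]].

Definition lfree (s : nat) (c : 'I_s -> L) : Prop :=
  forall a : 'I_s -> F, \sum_(i < s) a i *: c i = 0 -> forall i, a i = 0.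

Definition has_dim (s : nat) (W : set L) : Prop :=
  exists2 c : 'I_s -> L, lfree c & W = lspan c.

(* The Grassmannian of the s-dimensional subspaces of A. *)
Definition Gr (s : nat) (A : set L) : set (set L) :=
  [set W | has_dim s W /\ W `<=` A].

Definition subspace (W : set L) : Prop :=
  W 0 /\ forall (a : F) x y, W x -> W y -> W (a *: x + y).

Definition line (x : L) : set L := [set a *: x | a in [set: F]].

Definition direct_sum (A B : set L) : Prop :=
  (forall z, exists x y, [/\ A x, B y & z = x + y]) /\ A `&` B = [set 0].

End LinearAlgebra.

Section Jordan.
Variable F : fieldType.

(* The carrier is a parameter, so that the extensions J_theta are elements of
   one type, that of the Jordan algebra structures on J (+) V. *)
Record jordan (M : lmodType F) := Jordan {
  jmul :> M -> M -> M;
  jmul_bilinear : bilinear_for *:%R *:%R jmul;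
  jmulC : commutative jmul;
  jordan_identity : forall x y,
    jmul (jmul x x) (jmul x y) = jmul x (jmul (jmul x x) y)
}.

Section Structure.
Variables (M : lmodType F) (J : jordan M).

Definition Ann : set M := [set x | forall y, J x y = 0].

Definition ideal (I : set M) : Prop :=
  subspace I /\ forall x y, I x -> I (J x y).

Definition has_annihilator_component : Prop :=
  exists (I : set M) (x : M),
    [/\ ideal I, ideal (line x), direct_sum I (line x), x <> 0 & Ann x].

End Structure.

Record iso (M N : lmodType F) (J : jordan M) (K : jordan N) := Iso {
  isofun :> {linear M -> N};
  iso_bij : bijective isofun;
  iso_mul : {morph isofun : x y / J x y >-> K x y}
}.

Definition isomorphic (M N : lmodType F) (J : jordan M) (K : jordan N) : Prop :=
  inhabited (iso J K).

Definition aut (M : lmodType F) (J : jordan M) := iso J J.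

Definition iso_class (M : lmodType F) (E : set (jordan M)) (K : jordan M) :
  set (jordan M) := [set L | E L /\ isomorphic K L].

Definition iso_classes (M : lmodType F) (E : set (jordan M)) :
  set (set (jordan M)) := [set iso_class E K | K in E].

End Jordan.

Section Cohomology.
Variables (F : fieldType) (M : lmodType F) (J : jordan M) (V : lmodType F).

Definition is_cocycle (theta : M -> M -> V) : Prop :=
  [/\ bilinear_for *:%R *:%R theta,
      forall x y, theta x y = theta y x
    & forall x y, theta (J x x) (J x y) = theta x (J (J x x) y)].

Definition cocycle : {pred M -> M -> V} := fun theta => `[< is_cocycle theta >].

Lemma cocycle_submod : submod_closed cocycle.
Proof.
split=> [|a f g /asboolP[[fl fr] fC fJ] /asboolP[[gl gr] gC gJ]]; apply/asboolP.
  by split=> //; split=> u b x y; rewrite /= /GRing.zero /= scaler0 addr0.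
have E x y : (a *: f + g) x y = a *: f x y + g x y by [].
split=> [|x y|x y]; last 2 first.
- by rewrite !E fC gC.
- by rewrite !E fJ gJ.
have sw b (p q p' q' : V) :
    a *: (b *: p + q) + (b *: p' + q') = b *: (a *: p + p') + (a *: q + q').
  by rewrite !scalerDr !scalerA (mulrC a) addrACA.
split=> u b x y; rewrite !E.
  by have /= -> := fl u b x y; have /= -> := gl u b x y; exact: sw.
by rewrite fr gr; exact: sw.
Qed.

HB.instance Definition _ :=
  GRing.isSubmodClosed.Build F (M -> M -> V) cocycle cocycle_submod.

Record Z2 := Cocycle { Z2fun :> M -> M -> V; Z2P : Z2fun \in cocycle }.

HB.instance Definition _ := [isSub for Z2fun].
HB.instance Definition _ := [Choice of Z2 by <:].
HB.instance Definition _ := [SubChoice_isSubLmodule of Z2 by <:].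

Lemma Z2_cocycle (theta : Z2) : is_cocycle theta.
Proof. exact/asboolP/Z2P. Qed.

Lemma coboundary_subproof (f : {linear M -> V}) :
  (fun x y => f (J x y)) \in cocycle.
Proof.
apply/asboolP; split=> [|x y|x y]; last 2 first.
- by rewrite jmulC.
- by rewrite jordan_identity.
have [Jl Jr] := jmul_bilinear J.
split=> u b x y; rewrite -linearP; congr (f _); first exact: Jl.
exact: Jr.
Qed.

Definition coboundary (f : {linear M -> V}) : Z2 :=
  Cocycle (coboundary_subproof f).

Definition B2 : {pred Z2} :=
  fun theta => `[< exists f : {linear M -> V}, theta = coboundary f >].

Lemma B2_submod : submod_closed B2.
Proof.
split=> [|a _ _ /asboolP[f ->] /asboolP[g ->]]; apply/asboolP.
  by exists (GRing.null_fun V : {linear M -> V}); exact/val_inj.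
exists ((a \*: f) \+ g)%R.
exact/val_inj.
Qed.

HB.instance Definition _ := GRing.isSubmodClosed.Build F Z2 B2 B2_submod.

Lemma B2_oppr : oppr_closed B2.
Proof. by move=> x Bx; rewrite -scaleN1r rpredZ. Qed.

HB.instance Definition _ := GRing.isOppClosed.Build Z2 B2 B2_oppr.

Definition H2 := {ideal_quot B2}.
HB.instance Definition _ := GRing.Zmodule.on H2.

Definition cls (theta : Z2) : H2 := \pi_H2 theta.

Definition H2_scale (a : F) (x : H2) : H2 := cls (a *: repr x).

Lemma cls_eq (t u : Z2) : (cls t = cls u) <-> (t - u \in B2).
Proof. by rewrite Quotient.idealrBE; split=> [/eqP|/eqP]. Qed.

Lemma clsD (t u : Z2) : cls (t + u) = cls t + cls u.
Proof. by rewrite /cls piE. Qed.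

Lemma cls_repr (x : H2) : cls (repr x) = x.
Proof. exact: reprK. Qed.

Lemma H2_scale_cls a (t : Z2) : H2_scale a (cls t) = cls (a *: t).
Proof.
by apply/cls_eq; rewrite -scalerBr rpredZ //; apply/cls_eq; rewrite cls_repr.
Qed.

Fact H2_scaleA a b x : H2_scale a (H2_scale b x) = H2_scale (a * b) x.
Proof. by rewrite -[x]cls_repr !H2_scale_cls scalerA. Qed.

Fact H2_scale1 : left_id 1 H2_scale.
Proof. by move=> x; rewrite -[x]cls_repr H2_scale_cls scale1r. Qed.

Fact H2_scaleDr : right_distributive H2_scale +%R.
Proof.
by move=> a x y; rewrite -[x]cls_repr -[y]cls_repr -clsD !H2_scale_cls scalerDr clsD.
Qed.

Fact H2_scaleDl x : {morph H2_scale^~ x : a b / a + b}.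
Proof. by move=> a b; rewrite -[x]cls_repr !H2_scale_cls scalerDl clsD. Qed.

HB.instance Definition _ := GRing.Zmodule_isLmodule.Build F H2
  H2_scaleA H2_scale1 H2_scaleDr H2_scaleDl.

Fact cls_is_linear : linear cls.
Proof. by move=> a t u; rewrite clsD -H2_scale_cls. Qed.

HB.instance Definition _ := GRing.isLinear.Build F Z2 H2 _ cls cls_is_linear.

Definition radical (theta : Z2) : set M := [set x | forall y, theta x y = 0].

Section Extension.
Variable theta : Z2.

(* The product of J_theta on J (+) V; it ignores the V-components. *)
Definition ext_mul (p q : M * V) : M * V := (J p.1 q.1, theta p.1 q.1).

Fact ext_bilinear : bilinear_for *:%R *:%R ext_mul.
Proof.
have [Jl Jr] := jmul_bilinear J; have [[tl tr] _ _] := Z2_cocycle theta.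
split=> u b x y; congr (_, _); [exact: Jl|exact: tl|exact: Jr|exact: tr].
Qed.

Fact ext_mulC : commutative ext_mul.
Proof.
by move=> p q; have [_ tC _] := Z2_cocycle theta; rewrite /ext_mul jmulC tC.
Qed.

Fact ext_jordan p q :
  ext_mul (ext_mul p p) (ext_mul p q) = ext_mul p (ext_mul (ext_mul p p) q).
Proof.
by have [_ _ tJ] := Z2_cocycle theta; rewrite /ext_mul /= jordan_identity tJ.
Qed.

Definition ext : jordan (M * V)%type := Jordan ext_bilinear ext_mulC ext_jordan.

End Extension.

Section Action.
Variable phi : aut J.

Fact Z2_act_subproof (theta : Z2) :
  (fun x y => theta (phi x) (phi y)) \in cocycle.
Proof.
have [[tl tr] tC tJ] := Z2_cocycle theta.
apply/asboolP; split=> [|x y|x y]; last 2 first.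
- exact: tC.
- by rewrite !iso_mul tJ.
by split=> u b x y; rewrite linearP; [exact: tl|exact: tr].
Qed.

Definition Z2_act (theta : Z2) : Z2 := Cocycle (Z2_act_subproof theta).

(* Independent of the representative by H2_act_cls; on spans, see H2_act_span. *)
Definition H2_act (x : H2) : H2 := cls (Z2_act (repr x)).

Lemma H2_act_cls (theta : Z2) : H2_act (cls theta) = cls (Z2_act theta).
Proof.
apply/cls_eq; have /cls_eq /asboolP[f ef] := cls_repr (cls theta).
apply/asboolP; exists (f \o phi)%R; apply/val_inj/funext => x; apply/funext => y.
transitivity ((repr (cls theta) - theta) (phi x) (phi y)); first by [].
by rewrite ef /= iso_mul.
Qed.

End Action.

Definition aut_orbit (W : set H2) : set (set H2) :=
  [set H2_act phi @` W | phi in [set: aut J]].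

Definition aut_orbits (X : set (set H2)) : set (set (set H2)) :=
  [set aut_orbit W | W in X].

End Cohomology.

Arguments cocycle {F M} J V.

Section Extensions.
Variables (F : fieldType) (M : lmodType F) (J : jordan M) (s : nat).

Local Notation Z2F := (Z2 J F^o).
Local Notation H2F := (H2 J F^o).

Definition cls_span (theta : 'I_s -> Z2F) : set H2F :=
  lspan (fun i => cls (theta i)).

Lemma H2_act_span (phi : aut J) (theta : 'I_s -> Z2F) :
  H2_act phi @` cls_span theta = cls_span (fun i => Z2_act phi (theta i)).
Proof.
have H (a : 'I_s -> F) : H2_act phi (\sum_(i < s) a i *: cls (theta i)) =
    \sum_(i < s) a i *: cls (Z2_act phi (theta i)).
  under eq_bigr do rewrite -linearZ.
  rewrite -linear_sum H2_act_cls.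
  under [RHS]eq_bigr do rewrite -linearZ.
  rewrite -linear_sum; congr (cls _).
  elim/big_rec2: _ => [|i u w _ <-]; exact/val_inj.
apply/seteqP; split=> [_ [_ [a _ <-] <-]|_ [a _ <-]].
  by exists a => //; rewrite H.
by exists (\sum_(i < s) a i *: cls (theta i)); [exists a|rewrite H].
Qed.

(* W = cls_span theta has dimension s, hence theta represents a basis of W; the
   condition does not depend on the choice of theta. *)
Definition Ts : set (set H2F) :=
  [set W | Gr s [set: H2F] W /\ exists2 theta : 'I_s -> Z2F,
     W = cls_span theta &
     \bigcap_(i in [set: 'I_s]) radical (theta i) `&` Ann J = [set 0]].

Definition assoc_Z2 : set Z2F :=
  [set theta : Z2F | forall x y z, theta x (J y z) = theta (J x y) z].

Lemma assoc_coboundary (f : {linear M -> F^o}) :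
  associative J -> assoc_Z2 (coboundary J f).
Proof. by move=> JA x y z /=; rewrite JA. Qed.

(* For associative J every coboundary lies in assoc_Z2, so that this image is
   the quotient of assoc_Z2 by the coboundaries. *)
Definition assoc_H2 : set H2F := @cls F M J F^o @` assoc_Z2.

Definition Rs : set (set H2F) := Ts `&` Gr s assoc_H2.

Definition Us : set (set H2F) := Ts `\` Rs.

Variable V : lmodType F.

Definition EJ : set (jordan (M * V)%type) :=
  [set K | [/\ exists theta : Z2 J V, K = ext theta,
               ~ has_annihilator_component K & has_dim s (Ann K)]].

Definition ER : set (jordan (M * V)%type) := EJ `&` [set K | associative K].

Definition EU : set (jordan (M * V)%type) := EJ `\` ER.

Fact Z2_tensor_subproof (theta : Z2F) (v : V) :
  (fun x y => (theta x y : F) *: v) \in cocycle J V.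
Proof.
have [[tl tr] tC tJ] := Z2_cocycle theta.
apply/asboolP; split=> [|x y|x y]; last 2 first.
- by rewrite tC.
- by rewrite tJ.
split=> u b x y.
  have /= -> := tl u b x y; rewrite scalerDl; congr (_ + _).
  exact/esym/scalerA.
rewrite tr scalerDl; congr (_ + _); exact/esym/scalerA.
Qed.

Definition Z2_tensor (theta : Z2F) (v : V) : Z2 J V :=
  Cocycle (Z2_tensor_subproof theta v).

Definition Z2_comb (theta : 'I_s -> Z2F) (e : 'I_s -> V) : Z2 J V :=
  \sum_(i < s) Z2_tensor (theta i) (e i).

Lemma Z2_combE theta e x y :
  Z2_comb theta e x y = \sum_(i < s) (theta i x y : F) *: e i.
Proof.
rewrite /Z2_comb.
have H (r : seq 'I_s) : (\sum_(i <- r) Z2_tensor (theta i) (e i)) x y =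
    \sum_(i <- r) (theta i x y : F) *: e i.
  by elim: r => [|i r IH]; rewrite ?big_nil ?big_cons // -IH.
exact: H.
Qed.

End Extensions.

Arguments Rs {F M} J s.
Arguments Us {F M} J s.
Arguments ER {F M} J s V.
Arguments EU {F M} J s V.

(* Main.v *)
(* An isomorphism J_theta -> J_theta' preserves annihilators, which are both V
   when Ann(J) meets the radicals trivially; so it has the form
   x + v |-> phi(x) + g(x) + T v with phi in Aut(J) and T in GL(V), and
   multiplicativity says phi theta' = T theta + delta g.  In coordinates this
   means that phi maps the span of the classes of theta' to that of theta.
   An annihilator component is the same thing as a functional on J_theta which
   kills all products but not the annihilator, i.e., a linear relation between
   the classes [theta_i], and J_theta is associative iff every theta_i is in
   the associative part of Z^2; hence the orbit correspondence for T_s(J)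
   restricts to R_s(J) and to its complement U_s(J). *)
From HB Require Import structures.
Require Import Defs.
From mathcomp Require Import all_boot all_algebra.
From mathcomp Require Import boolp classical_sets functions.

Set Implicit Arguments.
Unset Strict Implicit.
Unset Printing Implicit Defensive.

Import GRing.Theory.

Local Open Scope classical_set_scope.
Local Open Scope ring_scope.

Lemma linear_ex (F : fieldType) (M N : lmodType F) (g : M -> N) :
  linear g -> exists f : {linear M -> N}, f =1 g.
Proof.
move=> gP; pose f : {linear M -> N} := HB.pack g (GRing.isLinear.Build F M N _ g gP).
by exists f.
Qed.

(** * Spans of [s] vectors and exchange of generators *)

Section Spans.
Variables (F : fieldType) (L : lmodType F) (s : nat).
Implicit Types c d : 'I_s -> L.

Lemma lspan_gen c i : lspan c (c i).
Proof.
exists (fun j => (j == i)%:R) => //.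
by rewrite (bigD1 i) //= eqxx scale1r big1 ?addr0 // => j /negPf->; rewrite scale0r.
Qed.

Lemma lspan_subspace c : subspace (lspan c).
Proof.
split; first by exists (fun=> 0) => //; rewrite big1 // => i _; rewrite scale0r.
move=> k _ _ [a _ <-] [b _ <-]; exists (fun i => k * a i + b i) => //.
rewrite scaler_sumr -big_split; apply: eq_bigr => i _ /=.
by rewrite scalerDl scalerA.
Qed.

Lemma sub_lspan c (W : set L) :
  subspace W -> (forall i, W (c i)) -> lspan c `<=` W.
Proof.
move=> [W0 WD] Wc _ [a _ <-]; elim/big_ind: _ => // [x y Wx Wy|i _].
  by rewrite -[x]scale1r; apply: WD.
by rewrite -[_ *: _]addr0; apply: WD.
Qed.

(** A row vector killed by the coefficient matrix [A] is a linear relation among the [c i], hence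
    zero; a square matrix with trivial left kernel is invertible. *)
Lemma lspan_matrix c d : lfree c -> lspan c `<=` lspan d ->
  exists2 A : 'M[F]_s, A \in unitmx & forall i, c i = \sum_j A i j *: d j.
Proof.
move=> cfree cd.
have /choice[A0 cE] : forall i, exists a : 'I_s -> F, \sum_j a j *: d j = c i.
  by move=> i; have [a _ <-] := cd _ (lspan_gen c i); exists a.
pose A := \matrix_(i, j) A0 i j.
have {}cE i : c i = \sum_j A i j *: d j.
  by rewrite -cE; apply: eq_bigr => j _; rewrite mxE.
exists A => //; rewrite -row_free_unit; apply: inj_row_free => u uA.
apply/rowP => i; rewrite mxE; apply: (cfree (fun i => u 0 i)).
under eq_bigr => k _ do rewrite cE scaler_sumr.
rewrite exchange_big big1 // => j _.
transitivity ((u *m A) 0 j *: d j); last by rewrite uA mxE scale0r.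
by rewrite mxE scaler_suml; apply: eq_bigr => k _; rewrite scalerA.
Qed.

(** Plays the role of a dimension count: inverting the transition matrix writes combinations of [d]
    through [c], which reverses the inclusion and transports freeness to [d]. *)
Lemma lspan_exchange c d :
  lfree c -> lspan c `<=` lspan d -> lfree d /\ lspan c = lspan d.
Proof.
move=> cfree cd; have [A Aunit cE] := lspan_matrix cfree cd.
have combV (a : 'I_s -> F) :
    \sum_j a j *: d j = \sum_i ((\row_j a j) *m invmx A) 0 i *: c i.
  under [RHS]eq_bigr => i _ do rewrite cE scaler_sumr.
  rewrite exchange_big; apply: eq_bigr => j _.
  have /rowP/(_ j) := mulmxKV Aunit (\row_j a j); rewrite !mxE => <-.
  by rewrite scaler_suml; apply: eq_bigr => i _; rewrite scalerA.
split=> [a|].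
  rewrite combV => /cfree a0 i.
  have u0 : (\row_j a j) *m invmx A = 0 by apply/rowP => k; rewrite a0 mxE.
  by have /rowP/(_ i) := mulmxKV Aunit (\row_j a j); rewrite u0 mul0mx !mxE.
apply/seteqP; split=> // _ [a _ <-]; rewrite combV.
by exists (fun i => ((\row_j a j) *m invmx A) 0 i).
Qed.

End Spans.

Section Jordan.
Variable F : fieldType.

(** * Annihilators and annihilator components *)

Section Bilinear.
Variables (M : lmodType F) (J : jordan M).

Lemma jmulDl x y z : J (x + y) z = J x z + J y z.
Proof. by have /= := (jmul_bilinear J).1 z 1 x y; rewrite !scale1r. Qed.

Lemma jmul0l z : J 0 z = 0.
Proof. by apply: (addrI (J 0 z)); rewrite -jmulDl !addr0. Qed.

Lemma jmulZl a x z : J (a *: x) z = a *: J x z.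
Proof.
by have /= := (jmul_bilinear J).1 z a x 0; rewrite jmul0l !addr0.
Qed.

Lemma Ann_subspace : subspace (Ann J).
Proof.
split=> [y|a x y Jx Jy z]; first exact: jmul0l.
by rewrite jmulDl jmulZl Jx Jy scaler0 addr0.
Qed.

(* An annihilator component F x corresponds to the projection p onto F x. *)
Lemma annihilator_componentP :
  has_annihilator_component J <->
  exists (p : {linear M -> F^o}) (x : M),
    [/\ Ann J x, p x = 1 & forall y z, p (J y z) = 0].
Proof.
split=> [[I [x [[[I0 ID] IJ] _ [Isum Icap] /eqP x0 Jx]]]|[p [x [Jx px pJ]]]].
  have Ix a : I (a *: x) -> a = 0.
    move=> Iax; have : (I `&` line x) (a *: x) by split=> //; exists a.
    by rewrite Icap /= => /eqP; rewrite scaler_eq0 (negPf x0) orbF => /eqP.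
  have /choice[p0 p0P] z : exists a : F, I (z - a *: x).
    by have [y [_ [Iy [a _ <-] ->]]] := Isum z; exists a; rewrite addrK.
  have IB y z : I y -> I z -> I (z - y).
    by move=> Iy Iz; rewrite addrC -scaleN1r; apply: ID.
  (* The coefficient along [x] is unique. Linearity of [p0], its value at [x] and its vanishing on
     products all follow from this. *)
  have p0E z a : I (z - a *: x) -> p0 z = a.
    move=> Iz; apply/eqP; rewrite -subr_eq0; apply/eqP/Ix.
    have -> : (p0 z - a) *: x = (z - a *: x) - (z - p0 z *: x).
      by rewrite scalerBl opprB [RHS]addrC addrA subrK.
    exact: IB.
  have [|p pE] := @linear_ex F M F^o p0.
    move=> a y z; apply: p0E.
    have -> : a *: y + z - (a *: (p0 y : F^o) + p0 z) *: x =
        a *: (y - p0 y *: x) + (z - p0 z *: x).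
      by rewrite scalerBr scalerA scalerDl opprD addrACA.
    by apply: ID.
  exists p, x; split=> // [|y z]; rewrite pE; apply: p0E.
    by rewrite scale1r subrr.
  (* Since [x] annihilates everything, [y] may be replaced by its component in the ideal [I], so the
     product lies in [I]. *)
  rewrite scale0r subr0 -[y](subrK (p0 y *: x)) jmulDl jmulZl Jx scaler0 addr0.
  exact: IJ.
have x0 : x <> 0.
  by move=> x0; move/eqP: px; rewrite x0 linear0 eq_sym oner_eq0.
(* The kernel of [p] contains all products, so it is an ideal, and [p x = 1] makes the line of [x] a
   complement. *)
exists [set z | p z = 0], x; split=> //.
- split=> [|y z _]; last exact: pJ.
  by split=> [|a y z /= y0 z0]; rewrite /= ?linear0 // linearP y0 z0 scaler0 addr0.
- split=> [|y z [a _ <-]].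
    split=> [|a _ _ [b _ <-] [c _ <-]]; first by exists 0; rewrite ?scale0r.
    by exists (a * b + c) => //; rewrite scalerDl scalerA.
  by exists 0 => //; rewrite scale0r jmulZl Jx scaler0.
split=> [z|].
  exists (z - p z *: x), (p z *: x); split; [|by exists (p z)|by rewrite subrK].
  by rewrite /= linearB linearZ /= px [_ *: _]mulr1 subrr.
apply/seteqP; split=> [y [/= py0 [a _ ay]]|_ ->].
  have a0 : a * 1 = 0 by rewrite -py0 -ay linearZ px.
  by rewrite -ay -[a]mulr1 a0 scale0r.
by split; [exact: linear0|exists 0; rewrite ?scale0r].
Qed.

End Bilinear.

(** * Isomorphisms and isomorphism classes *)

Section Isomorphisms.
Variables (M N P : lmodType F) (J : jordan M) (K : jordan N) (L : jordan P).

Lemma iso_inv (f : iso J K) : exists2 g : iso K J, cancel f g & cancel g f.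
Proof.
have [g0 fK gK] := iso_bij f.
have [a y z|g gE] := @linear_ex F N M g0.
  by apply: (can_inj fK); rewrite linearP !gK.
have gf : cancel f g by move=> x; rewrite gE fK.
have fg : cancel g f by move=> x; rewrite gE gK.
have gM : {morph g : x y / K x y >-> J x y}.
  by move=> x y; apply: (can_inj gf); rewrite iso_mul !fg.
have gb : bijective g by exists f.
by exists (Iso gb gM).
Qed.

Definition iso_id : iso J J :=
  @Iso F M M J J idfun (inv_bij (fun=> erefl)) (fun _ _ => erefl).

Lemma iso_comp_morph (f : iso J K) (g : iso K L) :
  {morph (g \o f)%R : x y / J x y >-> L x y}.
Proof. by move=> x y; rewrite /= !iso_mul. Qed.

Definition iso_comp (f : iso J K) (g : iso K L) : iso J L :=
  Iso (bij_comp (iso_bij g) (iso_bij f)) (@iso_comp_morph f g).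

Lemma Ann_iso (f : iso J K) x : Ann J x -> Ann K (f x).
Proof.
have [g _ gK] := iso_inv f.
by move=> Jx y; rewrite -[y]gK -iso_mul Jx linear0.
Qed.

End Isomorphisms.

Lemma isomorphic_sym (M N : lmodType F) (J : jordan M) (K : jordan N) :
  isomorphic J K -> isomorphic K J.
Proof. by move=> [f]; have [g _ _] := iso_inv f; split. Qed.

Lemma isomorphic_trans (M N P : lmodType F) (J : jordan M) (K : jordan N)
  (L : jordan P) : isomorphic J K -> isomorphic K L -> isomorphic J L.
Proof. by move=> [f] [g]; split; exact: iso_comp f g. Qed.

Lemma iso_class_eq (M : lmodType F) (E : set (jordan M)) (K L : jordan M) :
  E L -> iso_class E K = iso_class E L <-> isomorphic K L.
Proof.
move=> EL; split=> [KL|KL].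
  have [] : iso_class E K L by rewrite KL; split=> //; split; exact: iso_id.
  by [].
apply/seteqP; split=> N [EN iN]; split=> //.
  exact: isomorphic_trans (isomorphic_sym KL) iN.
exact: isomorphic_trans KL iN.
Qed.

(** * Orbits of the automorphism group *)

Section Orbits.
Variables (M : lmodType F) (J : jordan M) (V : lmodType F).

(** Cocycles are pulled back, so the map applied first, [f], acts last. *)
Lemma H2_act_comp (f g : aut J) (x : H2 J V) :
  H2_act (iso_comp f g) x = H2_act f (H2_act g x).
Proof. by rewrite -[x]cls_repr !H2_act_cls; congr cls; exact/val_inj. Qed.

Lemma H2_act_id (f : aut J) (x : H2 J V) : f =1 id -> H2_act f x = x.
Proof.
move=> f1; rewrite -[x]cls_repr H2_act_cls; congr cls; apply/val_inj.
by apply/funext => y; apply/funext => z; rewrite /= !f1.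
Qed.

Lemma aut_orbit_eq (W W' : set (H2 J V)) :
  aut_orbit W = aut_orbit W' <-> exists f : aut J, H2_act f @` W' = W.
Proof.
split=> [WW'|[f <-]].
  have : aut_orbit W W.
    exists (iso_id J) => //; apply/seteqP; split=> [_ [x Wx <-]|x Wx].
      by rewrite H2_act_id.
    by exists x; rewrite // H2_act_id.
  by rewrite WW' => -[f _]; exists f.
have [g fK gK] := iso_inv f.
apply/seteqP; split=> _ [h _ <-].
  exists (iso_comp h f) => //; rewrite image_comp.
  by apply: eq_imagel => x _; exact: H2_act_comp.
exists (iso_comp h g) => //.
rewrite image_comp; apply: eq_imagel => x _ /=.
by rewrite H2_act_comp -(H2_act_comp g f) (H2_act_id (f := iso_comp g f) _ gK).
Qed.

End Orbits.
End Jordan.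

(** * Classes described by values of cocycles *)

Section Cocycles.
Variables (F : fieldType) (M : lmodType F) (J : jordan M).

Lemma Z2_sumE (V : lmodType F) (s : nat) (a : 'I_s -> F)
    (theta : 'I_s -> Z2 J V) x y :
  (\sum_i a i *: theta i) x y = \sum_i a i *: theta i x y.
Proof.
have H (r : seq 'I_s) : (\sum_(i <- r) a i *: theta i) x y =
    \sum_(i <- r) a i *: theta i x y.
  by elim: r => [|i r IH]; rewrite ?big_nil ?big_cons // -IH.
exact: H.
Qed.

Lemma cls_eqP (V : lmodType F) (t u : Z2 J V) :
  cls t = cls u <->
  exists f : {linear M -> V}, forall x y, t x y = u x y + f (J x y).
Proof.
rewrite cls_eq; split=> [/asboolP[f tuf]|[f tuf]].
  exists f => x y; have /(congr1 (fun w : Z2 J V => w x y)) /= <- := tuf.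
  by rewrite addrC; apply/esym/subrK.
apply/asboolP; exists f; apply/val_inj/funext => x; apply/funext => y.
transitivity (t x y - u x y) => //.
by rewrite tuf addrC addKr.
Qed.

Variable s : nat.
Implicit Types theta : 'I_s -> Z2 J F^o.

Lemma sum_cls theta (a : 'I_s -> F) :
  \sum_i a i *: cls (theta i) = cls (\sum_i a i *: theta i).
Proof. by rewrite linear_sum; apply: eq_bigr => i _; rewrite linearZ. Qed.

Lemma cls_spanP theta (t : Z2 J F^o) : cls_span theta (cls t) <->
  exists (a : 'I_s -> F) (f : {linear M -> F^o}),
    forall x y, t x y = \sum_i a i *: theta i x y + f (J x y).
Proof.
split=> [[a _]|[a [f tE]]].
  rewrite sum_cls => /esym/cls_eqP[f tE]; exists a, f => x y.
  by rewrite tE Z2_sumE.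
exists a => //; rewrite sum_cls; apply/esym/cls_eqP; exists f => x y.
by rewrite tE Z2_sumE.
Qed.

Lemma lfree_clsP theta : lfree (fun i => cls (theta i)) <->
  forall (a : 'I_s -> F) (f : {linear M -> F^o}),
    (forall x y, \sum_i a i *: theta i x y = f (J x y)) -> forall i, a i = 0.
Proof.
have cls0 : cls (0 : Z2 J F^o) = 0 by exact: linear0.
split=> H a; last first.
  rewrite sum_cls -cls0 => /cls_eqP[f tE]; apply: (H a f) => x y.
  by rewrite -Z2_sumE tE [X in X + _](_ : _ = 0) // add0r.
move=> f tE; apply: H; rewrite sum_cls -cls0; apply/cls_eqP; exists f => x y.
by rewrite Z2_sumE tE [X in X + _](_ : _ = 0) // add0r.
Qed.

(** A relation among the transformed classes, evaluated at preimages under [phi], becomes a relation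
    among the original ones. *)
Lemma lfree_act (phi : aut J) theta : lfree (fun i => cls (theta i)) ->
  lfree (fun i => cls (Z2_act phi (theta i))).
Proof.
move=> /lfree_clsP thfree; apply/lfree_clsP => a f fE.
have [psi _ psiK] := iso_inv phi.
apply: (thfree a (f \o psi)%R) => x y.
by rewrite /= iso_mul -fE /= !psiK.
Qed.

Lemma assoc_H2_subspace : associative J -> subspace (assoc_H2 (J := J)).
Proof.
move=> JA; split; first by exists 0; [move=> x y z|exact: linear0].
move=> a _ _ [t tA <-] [u uA <-]; exists (a *: t + u); last by rewrite linearP.
move=> x y z.
by transitivity (a *: t x (J y z) + u x (J y z)) => //; rewrite tA uA.
Qed.

(** Two representatives differ by some [f (J x y)], which itself satisfies the associativity
    condition when [J] is associative. *)
Lemma assoc_H2_cls (t : Z2 J F^o) :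
  associative J -> assoc_H2 (cls t) <-> assoc_Z2 t.
Proof.
move=> JA; split=> [[u uA /esym/cls_eqP[f tE]] x y z|]; last by exists t.
by rewrite !tE uA JA.
Qed.

End Cocycles.

(** * Annihilators of extensions and induced automorphisms *)

Section Extensions.
Variables (F : fieldType) (M : lmodType F) (J : jordan M) (V : lmodType F).

Lemma cocycle0l (theta : Z2 J V) y : theta 0 y = 0.
Proof.
have [[tl _] _ _] := Z2_cocycle theta.
by have /= := tl y (-1) 0 0; rewrite scaler0 addr0 scaleN1r addNr.
Qed.

Lemma Ann_ext (theta : Z2 J V) (p : M * V) :
  Ann (ext theta) p <-> Ann J p.1 /\ radical theta p.1.
Proof.
split=> [Kp|[Jp tp] q]; last by rewrite /= /ext_mul Jp tp.
by split=> y; have := Kp (y, 0); [move/(congr1 fst)|move/(congr1 snd)].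
Qed.

Lemma Ann_ext0 (theta : Z2 J V) v : Ann (ext theta) (0, v).
Proof. by apply/Ann_ext; split=> y; [exact: jmul0l|exact: cocycle0l]. Qed.

Lemma Ann_ext_nondegenerate (theta : Z2 J V) (p : M * V) :
  Ann J `&` radical theta `<=` [set 0] -> Ann (ext theta) p -> p.1 = 0.
Proof. by move=> nd /Ann_ext/nd. Qed.

(* An isomorphism preserves the annihilator 0 (+) V, hence induces a map on
   the quotient M. *)
Lemma iso_ext_fst (theta theta' : Z2 J V) (f : iso (ext theta) (ext theta')) :
  Ann J `&` radical theta' `<=` [set 0] ->
  forall x v, (f (x, v)).1 = (f (x, 0)).1.
Proof.
move=> nd x v.
have f0 : (f (0, v)).1 = 0.
  apply: (Ann_ext_nondegenerate nd); apply: Ann_iso; exact: Ann_ext0.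
have -> : (x, v) = (x, 0) + (0, v) :> M * V.
  by congr (_, _); rewrite ?addr0 ?add0r.
by rewrite linearD /= f0 addr0.
Qed.

(** Nondegeneracy on both sides lets [f] and its inverse descend to the quotient by [0 (+) V], where
    the induced maps are mutually inverse. *)
Lemma iso_ext_aut (theta theta' : Z2 J V) (f : iso (ext theta) (ext theta')) :
  Ann J `&` radical theta `<=` [set 0] ->
  Ann J `&` radical theta' `<=` [set 0] ->
  exists phi : aut J, forall x v, (f (x, v)).1 = phi x.
Proof.
move=> nd nd'; have [g fK gK] := iso_inv f.
have fE := iso_ext_fst f nd'; have gE := iso_ext_fst g nd.
have [a x y|phi phiE] := @linear_ex F M M (fun x => (f (x, 0)).1).
  rewrite -[RHS]/((a *: f (x, 0) + f (y, 0)).1) -linearP; congr (f _).1.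
  by congr (_, _); rewrite /= ?scaler0 ?addr0.
(* The second component of [h (x, 0)] can be restored, because it does not affect the first
   component of [k]. *)
have inv (h k : M * V -> M * V) : cancel h k ->
    (forall x v, (k (x, v)).1 = (k (x, 0)).1) ->
    forall x, (k ((h (x, 0)).1, 0)).1 = x.
  by move=> hK kE x; rewrite -(kE _ (h (x, 0)).2) -surjective_pairing hK.
have phib : bijective phi.
  exists (fun x => (g (x, 0)).1) => x; rewrite phiE; first exact: (inv f g).
  exact: (inv g f).
have phiM : {morph phi : x y / J x y}.
  move=> x y; rewrite !phiE.
  have := iso_mul f (x, 0) (y, 0) => /(congr1 fst) /= <-.
  by rewrite /ext_mul /= fE.
by exists (Iso phib phiM) => x v; rewrite /= phiE.
Qed.

End Extensions.

(** * Subspaces of classes versus extensions, in a basis of [V] *)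

Section Correspondence.
Variables (F : fieldType) (M : lmodType F) (J : jordan M) (s : nat).
Variables (V : vectType F) (e : s.-tuple V).
Hypothesis e_basis : basis_of {:V} e.

Local Notation comb theta := (Z2_comb theta (tnth e)).
Implicit Types theta : 'I_s -> Z2 J F^o.

Lemma coord_tnth (k : 'I_s -> F) j : coord e j (\sum_i k i *: tnth e i) = k j.
Proof.
under eq_bigr do rewrite (tnth_nth 0).
exact/coord_sum_free/(basis_free e_basis).
Qed.

Lemma coord_tnthK v : \sum_i coord e i v *: tnth e i = v.
Proof.
under eq_bigr do rewrite (tnth_nth 0).
exact/esym/coord_basis/memvf.
Qed.

Lemma coord_comb theta i x y : coord e i (comb theta x y) = theta i x y.
Proof. by rewrite Z2_combE coord_tnth. Qed.

(** The coordinates of [theta] along the basis are scalar cocycles. *)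
Lemma combP (theta : Z2 J V) : exists theta0, theta = comb theta0.
Proof.
have [[tl tr] tC tJ] := Z2_cocycle theta.
have coc i : (fun x y => coord e i (theta x y) : F^o) \in cocycle J F^o.
  apply/asboolP; split=> [|x y|x y]; last 2 first.
  - by rewrite tC.
  - by rewrite tJ.
  split=> z a x y.
    by have /= -> := tl z a x y; rewrite linearP.
  by have /= -> := tr z a x y; rewrite linearP.
exists (fun i => Cocycle (coc i)); apply/val_inj/funext => x; apply/funext => y.
by rewrite [RHS]Z2_combE /= coord_tnthK.
Qed.

Lemma radical_comb theta :
  radical (comb theta) = \bigcap_(i in [set: 'I_s]) radical (theta i).
Proof.
apply/seteqP; split=> x tx; last first.
  move=> y; rewrite Z2_combE big1 // => i _.
  by have -> := tx i I y; rewrite scale0r.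
by move=> i _ y; rewrite -coord_comb tx linear0.
Qed.

(** Equivalently, by [Ann_ext], the annihilator of the extension is exactly [0 (+) V]. *)
Definition nondegenerate theta := Ann J `&` radical (comb theta) `<=` [set 0].

(** Another family with the same span consists of combinations of the [theta i] plus coboundaries,
    and coboundaries vanish on [Ann J]; so the radical condition passes to [theta]. Freeness comes
    from the dimension by exchange. *)
Lemma Ts_comb theta : Ts s (cls_span theta) <->
  lfree (fun i => cls (theta i)) /\ nondegenerate theta.
Proof.
split=> [[[[c cfree cE] _] [theta' tt' nd]]|[thfree nd]].
  have [|thfree _] := @lspan_exchange _ _ s c (fun i => cls (theta i)) cfree.
    by rewrite -cE.
  split=> // x [Jx]; rewrite radical_comb => tx.
  rewrite -nd; split=> // i _ y.
  have /cls_spanP[a [f ->]] : cls_span theta (cls (theta' i)).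
    by rewrite tt'; apply: lspan_gen.
  rewrite Jx linear0 addr0 big1 // => j _.
  by have -> := tx j I y; rewrite scaler0.
split; first by split=> //; exists (fun i => cls (theta i)).
exists theta => //; rewrite -radical_comb; apply/seteqP; split=> [x [tx Jx]|_ ->].
  exact: nd.
by split=> y; [exact: cocycle0l|exact: jmul0l].
Qed.

(** The annihilator always contains the [s]-dimensional [0 (+) V], so having dimension [s] forces
    equality by exchange. *)
Lemma has_dim_Ann_comb theta :
  has_dim s (Ann (ext (comb theta))) <-> nondegenerate theta.
Proof.
pose d i : M * V := (0, tnth e i).
have dE (a : 'I_s -> F) : \sum_i a i *: d i = (0, \sum_i a i *: tnth e i).
  rewrite [LHS]surjective_pairing !(raddf_sum fst, raddf_sum snd).
  by congr (_, _); rewrite big1 //= => i _; rewrite scaler0.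
have dfree : lfree d.
  move=> a; rewrite dE => /(congr1 snd)/= a0 i.
  by rewrite -(coord_tnth a) a0 linear0.
have dspan v : lspan d (0, v).
  by exists (fun i => coord e i v); rewrite // dE coord_tnthK.
have dAnn : lspan d `<=` Ann (ext (comb theta)).
  apply: sub_lspan; first exact: Ann_subspace.
  by move=> i; exact: Ann_ext0.
split=> [[c cfree cE] x [Jx tx]|nd].
  move: dAnn; rewrite cE => /(lspan_exchange dfree)[_ dc].
  have : Ann (ext (comb theta)) (x, 0) by apply/Ann_ext.
  by rewrite cE -dc => -[a _]; rewrite dE => /(congr1 fst).
exists d => //; apply/seteqP; split=> // -[x v] /(Ann_ext_nondegenerate nd)/= ->.
exact: dspan.
Qed.

Lemma annihilator_component_comb theta : nondegenerate theta ->
  has_annihilator_component (ext (comb theta)) <->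
  ~ lfree (fun i => cls (theta i)).
Proof.
move=> nd; rewrite annihilator_componentP; split.
  move=> [p [[x v] [/(Ann_ext_nondegenerate nd)/= -> p1 pJ]]] /lfree_clsP thfree.
  have pD y w : p (y, w) = p (y, 0) + p (0, w).
    by rewrite -linearD; congr (p _); congr (_, _); rewrite ?addr0 ?add0r.
  have [a y z|f fE] := @linear_ex F M F^o (fun y => - p (y, 0)).
    rewrite scalerN -opprD -linearP; congr (- p _).
    by congr (_, _); rewrite /= ?scaler0 ?addr0.
  have [a y z|g gE] := @linear_ex F V F^o (fun v => p (0, v)).
    by rewrite -linearP; congr (p _); congr (_, _); rewrite /= ?scaler0 ?addr0.
  (* That [p] kills the product of [(y, 0)] and [(z, 0)] is a relation among the classes: the
     coefficients are the values of [p] on the basis of [V], and [f], minus [p] on [M], gives the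
     coboundary. *)
  have a0 i : g (tnth e i) = 0.
    apply: (thfree (fun i => g (tnth e i)) f) => y z.
    have := pJ (y, 0) (z, 0); rewrite /= /ext_mul /= pD => /eqP.
    rewrite addrC addr_eq0 -gE fE => /eqP <-; rewrite Z2_combE linear_sum.
    by apply: eq_bigr => j _; rewrite linearZ; exact: mulrC.
  move/eqP: p1; rewrite -gE -(coord_tnthK v) linear_sum big1 => [|i _].
    by rewrite eq_sym oner_eq0.
  by rewrite linearZ /= a0 scaler0.
move=> thfree; apply: contrapT => nocomp; apply: thfree; apply/lfree_clsP.
move=> a f fE i; apply: contrapT => /eqP ai0; apply: nocomp.
(* The functional on [V] with value [a j] at the basis vector of index [j]; the relation [fE] says
   that [alpha] minus [f] kills all products. *)
pose alpha (v : V) : F := \sum_j a j * coord e j v.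
have alphaP b v w : alpha (b *: v + w) = b * alpha v + alpha w.
  rewrite /alpha mulr_sumr -big_split; apply: eq_bigr => j _ /=.
  by rewrite linearP mulrDr mulrCA.
have alphaE k : alpha (\sum_j k j *: tnth e j) = \sum_j a j * k j.
  by apply: eq_bigr => j _; rewrite coord_tnth.
have [b q r|p pE] := @linear_ex F (M * V)%type F^o (fun q => alpha q.2 - f q.1).
  by rewrite /= alphaP linearP opprD addrACA scalerBr.
(* The vector is the basis vector of index [i] divided by [a i], normalised so that [p] takes the
   value 1. *)
exists p, (0, \sum_j ((j == i)%:R / a i) *: tnth e j); split.
- exact: Ann_ext0.
- rewrite pE /= linear0 subr0 alphaE (bigD1 i) //= big1 => [|j /negPf ->]; last by rewrite mul0r mulr0.
  by rewrite eqxx addr0 mul1r divff.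
- move=> q r; rewrite pE /= -fE; apply/eqP; rewrite subr_eq0; apply/eqP.
  by apply: eq_bigr => j _; rewrite coord_comb.
Qed.

Lemma EJ_comb theta : EJ J s (V := V) (ext (comb theta)) <-> Ts s (cls_span theta).
Proof.
rewrite Ts_comb; split=> [[_ nocomp /has_dim_Ann_comb nd]|[thfree nd]].
  split=> //; apply: contrapT => thfree; apply: nocomp.
  exact/annihilator_component_comb.
split; [by exists (comb theta)| |exact/has_dim_Ann_comb].
by move/(annihilator_component_comb nd).
Qed.

(** The [V]-component of associativity in the extension is, in each coordinate, the identity
    defining [assoc_Z2]. *)
Lemma associative_comb theta : associative J ->
  associative (ext (comb theta)) <-> cls_span theta `<=` assoc_H2 (J := J).
Proof.
move=> JA; split=> [KA|thA].
  apply: sub_lspan => [|i]; first exact: assoc_H2_subspace.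
  apply/assoc_H2_cls => // x y z; rewrite -!coord_comb.
  by have /(congr1 snd) /= -> := KA (x, 0) (y, 0) (z, 0).
have {}thA i : assoc_Z2 (theta i).
  by apply/assoc_H2_cls => //; apply/thA/lspan_gen.
move=> p q r; rewrite /= /ext_mul /= JA !Z2_combE; congr (_, _).
by apply: eq_bigr => i _; rewrite thA.
Qed.

Lemma isomorphic_comb theta theta' :
    Ts s (cls_span theta) -> Ts s (cls_span theta') ->
  isomorphic (ext (comb theta)) (ext (comb theta')) <->
  aut_orbit (cls_span theta) = aut_orbit (cls_span theta').
Proof.
move=> /Ts_comb[thfree nd] /Ts_comb[th'free nd']; rewrite aut_orbit_eq.
split=> [[f]|[phi]].
  have [phi phiE] := iso_ext_aut f nd nd'; exists phi.
  rewrite H2_act_span.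
  (* One inclusion suffices by exchange, since the transformed classes remain free. *)
  suff sub : cls_span (fun i => Z2_act phi (theta' i)) `<=` cls_span theta.
    exact: (lspan_exchange (lfree_act th'free) sub).2.
  have [a v w|T TE] := @linear_ex F V V (fun v => (f (0, v)).2).
    rewrite -[RHS]/((a *: f (0, v) + f (0, w)).2) -linearP; congr (f _).2.
    by congr (_, _); rewrite /= ?scaler0 ?addr0.
  apply: sub_lspan => [|i]; first exact: lspan_subspace.
  have [a x y|g gE] := @linear_ex F M F^o (fun x => coord e i (f (x, 0)).2).
    rewrite -linearP; congr (coord e i _).
    rewrite -[RHS]/((a *: f (x, 0) + f (y, 0)).2) -linearP; congr (f _).2.
    by congr (_, _); rewrite /= ?scaler0 ?addr0.
  (* Coordinate [i] of the [V]-component of multiplicativity: [T], the restriction of [f] to [V],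
     supplies the coefficients, and [g], coming from [f] on [M], the coboundary. *)
  apply/cls_spanP; exists (fun j => coord e i (T (tnth e j))), g => x y.
  have /(congr1 snd) := iso_mul f (x, 0) (y, 0).
  rewrite /= /ext_mul /= !phiE => /(congr1 (coord e i)).
  rewrite coord_comb => <-.
  have -> : (J x y, comb theta x y) = (J x y, 0) + (0, comb theta x y) :> M * V.
    by congr (_, _); rewrite ?addr0 ?add0r.
  rewrite linearD /= linearD /= gE addrC -TE; congr (_ + _).
  rewrite Z2_combE !linear_sum; apply: eq_bigr => j _.
  by rewrite !linearZ; exact: mulrC.
rewrite H2_act_span => thE.
have sub : cls_span (fun i => Z2_act phi (theta' i)) `<=` cls_span theta.
  by rewrite thE.
have [A Aunit AE] := lspan_matrix (lfree_act th'free) sub.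
have /choice[g gE] i : exists g : {linear M -> F^o}, forall x y,
    theta' i (phi x) (phi y) = \sum_j A i j *: theta j x y + g (J x y).
  have := AE i; rewrite sum_cls => /cls_eqP[g gE]; exists g => x y.
  by rewrite -Z2_sumE -gE.
(* The endomorphism of [V] with matrix [B] in the basis [e]. With the transition matrix [A] and the
   coboundary terms [g], it yields the isomorphism [(x, v) |-> (phi x, G x + T A v)]. *)
pose T (B : 'M[F]_s) v := \sum_i (\sum_j B i j * coord e j v) *: tnth e i.
have TM B C v : T B (T C v) = T (B *m C) v.
  apply: eq_bigr => i _; congr (_ *: _).
  under eq_bigr => j _ do rewrite coord_tnth mulr_sumr.
  rewrite exchange_big; apply: eq_bigr => k _.
  by rewrite mxE mulr_suml; apply: eq_bigr => j _; rewrite mulrA.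
have T1 v : T 1%:M v = v.
  rewrite -[RHS]coord_tnthK; apply: eq_bigr => i _; congr (_ *: _).
  rewrite (bigD1 i) //= big1 => [|j /negPf ji]; rewrite mxE ?eqxx.
    by rewrite mul1r addr0.
  by rewrite eq_sym ji mul0r.
have TP B a v w : T B (a *: v + w) = a *: T B v + T B w.
  rewrite scaler_sumr -big_split; apply: eq_bigr => i _ /=.
  rewrite scalerA -scalerDl mulr_sumr -big_split; congr (_ *: _).
  by apply: eq_bigr => j _; rewrite linearP mulrDr mulrCA.
pose G x := \sum_i (g i x : F) *: tnth e i.
have GP a x y : G (a *: x + y) = a *: G x + G y.
  rewrite scaler_sumr -big_split; apply: eq_bigr => i _ /=.
  by rewrite scalerA -scalerDl linearP.
have [a p q|f fE] :=
    @linear_ex F (M * V)%type (M * V)%type (fun p => (phi p.1, G p.1 + T A p.2)).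
  congr (_, _); first exact: linearP.
  by rewrite GP TP /= scalerDr addrACA.
have fb : bijective f.
  have [psi phiK psiK] := iso_inv phi.
  (* The map is triangular: recover [x] first, subtract [G x], then undo [T A]. *)
  exists (fun p => (psi p.1, T (invmx A) (p.2 - G (psi p.1)))) => -[x v].
    by rewrite fE /= phiK addrC addKr TM mulVmx // T1.
  by rewrite fE /= psiK TM mulmxV // T1 addrC subrK.
(* In each coordinate of [V], multiplicativity is the identity [gE]. *)
have fM : {morph f : p q / ext (comb theta) p q >-> ext (comb theta') p q}.
  move=> p q; rewrite !fE /= /ext_mul /= iso_mul; congr (_, _).
  rewrite [RHS]Z2_combE -big_split; apply: eq_bigr => i _ /=.
  rewrite -scalerDl gE addrC; congr ((_ + _) *: _).
  by apply: eq_bigr => j _; rewrite coord_comb.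
by split; exact: Iso fb fM.
Qed.

(** Stated for an arbitrary matching pair [X], [E], so that it serves both the associative part and
    its complement. *)
Lemma orbit_correspondence (X : set (set (H2 J F^o)))
    (E : set (jordan (M * V)%type)) :
    X `<=` Ts s -> E `<=` EJ J s (V := V) ->
    (forall theta, E (ext (comb theta)) <-> X (cls_span theta)) ->
  exists2 Phi, set_bij (aut_orbits X) (iso_classes E) Phi &
    forall theta, X (cls_span theta) ->
      Phi (aut_orbit (cls_span theta)) = iso_class E (ext (comb theta)).
Proof.
move=> XT EE EX.
(* Ranging over all representatives of the orbit avoids a choice; [PhiE] shows that each of them
   gives the same class. *)
pose Phi (O : set (set (H2 J F^o))) : set (jordan (M * V)%type) :=
  [set L | E L /\ exists theta, [/\ X (cls_span theta),
     aut_orbit (cls_span theta) = O & isomorphic (ext (comb theta)) L]].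
have PhiE theta : X (cls_span theta) ->
    Phi (aut_orbit (cls_span theta)) = iso_class E (ext (comb theta)).
  move=> Xth; apply/seteqP; split=> L [EL]; last by split=> //; exists theta.
  move=> [theta' [Xth' th'E iL]]; split=> //; apply: isomorphic_trans iL.
  exact/(isomorphic_comb (XT _ Xth) (XT _ Xth')).
have XP W : X W -> exists theta, W = cls_span theta.
  by move=> /XT[_ [theta ->]]; exists theta.
exists Phi => //; split=> [_ [W XW <-]|O O'|_ [K EK <-]].
- have [theta WE] := XP W XW; rewrite WE in XW *; rewrite PhiE //.
  by exists (ext (comb theta)) => //; apply/EX.
- move=> /set_mem[W XW <-] /set_mem[W' XW' <-].
  have [theta WE] := XP W XW; have [theta' WE'] := XP W' XW'.
  rewrite WE in XW *; rewrite WE' in XW' *; rewrite !PhiE //.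
  move/iso_class_eq => iK; apply/(isomorphic_comb (XT _ XW) (XT _ XW')).
  exact/iK/EX.
- have [[th KE] _ _] := EE _ EK; have [theta thE] := combP th.
  move: EK; rewrite KE thE => /EX Xth.
  by exists (aut_orbit (cls_span theta)); [exists (cls_span theta)|rewrite PhiE].
Qed.

Lemma ER_comb theta : associative J ->
  ER J s V (ext (comb theta)) <-> Rs J s (cls_span theta).
Proof.
move=> JA; split=> -[].
  by move=> /EJ_comb Tth /(associative_comb _ JA) thA; split=> //; case: Tth => -[].
by move=> /EJ_comb Eth [_ thA]; split=> //; exact/associative_comb.
Qed.

Lemma EU_comb theta : associative J ->
  EU J s V (ext (comb theta)) <-> Us J s (cls_span theta).
Proof. by move=> JA; rewrite /EU /Us /setD /= EJ_comb ER_comb. Qed.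

End Correspondence.

Theorem theorem4p10 (F : fieldType) (M : lmodType F) (J : jordan M)
    (J_assoc : associative J) (s : nat) (V : vectType F) (e : s.-tuple V)
    (e_basis : basis_of {:V} e) :
  (exists2 Phi : set (set (H2 J F^o)) -> set (jordan (M * V)%type),
     set_bij (aut_orbits (Rs J s)) (iso_classes (ER J s V)) Phi
   & forall theta : 'I_s -> Z2 J F^o, Rs J s (cls_span theta) ->
       Phi (aut_orbit (cls_span theta)) =
       iso_class (ER J s V) (ext (Z2_comb theta (tnth e))))
  /\
  (exists2 Phi : set (set (H2 J F^o)) -> set (jordan (M * V)%type),
     set_bij (aut_orbits (Us J s)) (iso_classes (EU J s V)) Phi
   & forall theta : 'I_s -> Z2 J F^o, Us J s (cls_span theta) ->
       Phi (aut_orbit (cls_span theta)) =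
       iso_class (EU J s V) (ext (Z2_comb theta (tnth e)))).
Proof.
split; apply: (orbit_correspondence e_basis).
- by move=> W [].
- by move=> K [].
- by move=> theta; exact: ER_comb.
- by move=> W [].
- by move=> K [].
- by move=> theta; exact: EU_comb.
Qed.
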